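(* Let $\beta,\gamma,a,b,c,A,B$ be real constants, with $a$ or $b$ a non-positive integer, and let $n$ be a natural number. Each of the following four quadratic polynomial differential systems is Liouvillian integrable: (i) $$\begin{aligned} \dot x={}&x(1-x),\\ \dot y={}&y^2+(2\beta-a-b+1)xy+(c-1+2\gamma)y+\gamma(\gamma+c-1)\\ &+\bigl(\beta^2+(2-a-b)\beta+(a-1)(b-1)\bigr)x^2+\bigl(c\beta-ab+(1-\gamma)(-2\beta-1+a+b)\bigr)x; \end{aligned}$$ (ii) $$\begin{aligned} \dot x={}&1-x^2,\\ \dot y={}&y^2+(2\beta-A-B)xy+(2\gamma+A-B)y\\ &+\bigl(\beta^2+\beta-n(n+1)-(1+n+\beta)(A+B)\bigr)x^2+\bigl((\beta-\gamma)A-(\gamma+\beta)B+2\gamma\beta\bigr)x\\ &+(n+1-\gamma)B+(n+1+\gamma)A+n(n+1)+\gamma^2-\beta; \end{aligned}$$ (iii) $$\begin{aligned} \dot x={}&x,\\ \dot y={}&y^2+(2\beta-1)xy+(2\gamma+A)y+(\beta-1)\beta x^2+\bigl(\beta(A+2\gamma-1)+n+1-\gamma\bigr)x+A\gamma+\gamma^2; \end{aligned}$$ (iv) $$\begin{aligned} \dot x={}&1,\\ \dot y={}&y^2+(2\beta-1)xy+2\gamma y+(\beta^2-2\beta)x^2+2\gamma(\beta-1)x+\gamma^2-\beta+2(n+1). \end{aligned}$$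
   Context: A (generalized) Darboux function is a (multi-valued) function of the form $f_1^{\lambda_1}\cdots f_p^{\lambda_p}e^{\mu_1g_1/h_1}\cdots e^{\mu_qg_q/h_q}$ with $f_i,g_j,h_j\in\mathbb C[x,y]$ and $\lambda_i,\mu_j\in\mathbb C$. Let $\mathcal X=(P,Q)$ be the polynomial vector field of $\dot x=P(x,y)$, $\dot y=Q(x,y)$, and let $U$ be an open dense subset of $\mathbb R^2$. A first integral on $U$ is a non-constant $C^1$ function $H$ with $\mathcal XH=P\,\partial H/\partial x+Q\,\partial H/\partial y=0$ on $U$. An integrating factor on $U$ is a non-constant function $R$ with $\mathcal XR=-R\,(\partial P/\partial x+\partial Q/\partial y)$ on $U$. The system is Liouvillian integrable if it has a first integral or an integrating factor given by a generalized Darboux function. In (i), it is assumed that $c$ is not a non-positive integer (so that the hypergeometric polynomial ${}_2F_1(a,b;c;x)$ is defined). In (ii) and (iii) the parameters are those for which the associated Jacobi, respectively Laguerre, polynomial exists: there is a nonzero polynomial solution of degree $n$ of $(1-x^2)f''+(A-B-(A+B+2)x)f'+n(n+A+B+1)f=0$, respectively of $xf''+(A+1-x)f'+nf=0$.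
   Formalization: In (iv) the coefficient of xy is 2β−2 instead of the printed 2β−1, which is a misprint: for β=−1/4, γ=1 the printed system reduces to an Airy equation and is not Liouvillian integrable. *)

(* Defs.v *)
From HB Require Import structures.
From mathcomp Require Import all_boot all_order all_algebra.
From mathcomp Require Import all_classical all_reals all_analysis.
From mathcomp Require Import complex.

Set Implicit Arguments.
Unset Strict Implicit.
Unset Printing Implicit Defensive.
Import Order.TTheory GRing.Theory Num.Theory.
Import numFieldNormedType.Exports.

Local Open Scope classical_set_scope.
Local Open Scope ring_scope.
Local Open Scope complex_scope.

(* A polynomial in x, y over K is a {poly {poly K}}, with 'X for x and 'Y for y,
   so that p.[x, y] (polyXY.v) is its value; k%:K2 is the constant k. *)
Notation "k %:K2" := (k%:P%:P) (at level 2, only parsing)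
  : ring_scope.

Section PlanarSystems.
Variable R : realType.
Implicit Types (P Q : {poly {poly R}}) (U : set (R * R)%type)
  (H : (R * R)%type -> R[i]).

Definition peval P (u : (R * R)%type) : R := P.[u.1, u.2].

Definition pevalC (f : {poly {poly R[i]}}) (u : (R * R)%type) : R[i] :=
  f.[u.1%:C, u.2%:C].

Definition e_x : (R * R)%type := (1, 0).
Definition e_y : (R * R)%type := (0, 1).

(* R[i] carries no normed R-module structure in the libraries: regularity and
   real partial derivatives of complex-valued functions are componentwise. *)
Definition ReF H : (R * R)%type -> R := fun u => complex.Re (H u).
Definition ImF H : (R * R)%type -> R := fun u => complex.Im (H u).

Definition partialC (v : (R * R)%type) H : (R * R)%type -> R[i] :=
  fun u => 'D_v (ReF H) u +i* 'D_v (ImF H) u.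

Definition continuous_onC U H : Prop :=
  forall u, U u -> {for u, continuous (ReF H)} /\ {for u, continuous (ImF H)}.

Definition differentiable_onC U H : Prop :=
  forall u, U u -> differentiable (ReF H) u /\ differentiable (ImF H) u.

Definition C1_onC U H : Prop :=
  [/\ differentiable_onC U H, continuous_onC U (partialC e_x H)
    & continuous_onC U (partialC e_y H)].

Definition cexp (z : R[i]) : R[i] :=
  (expR (complex.Re z) * cos (complex.Im z))
    +i* (expR (complex.Re z) * sin (complex.Im z)).

(* H is, on U, a single-valued branch of
     f_1^lam_1 ... f_p^lam_p exp (mu_1 g_1/h_1) ... exp (mu_q g_q/h_q),
   where f_i^lam_i = exp (lam_i L_i) and L_i is a continuous branch of log f_i
   on U; cexp (L_i) = f_i forces f_i to have no zero on U. *)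
Definition darboux_on U H : Prop :=
  exists (p q : nat)
    (f : 'I_p -> {poly {poly R[i]}}) (lam : 'I_p -> R[i])
    (L : 'I_p -> (R * R)%type -> R[i])
    (g h : 'I_q -> {poly {poly R[i]}}) (mu : 'I_q -> R[i]),
    [/\ forall i, continuous_onC U (L i),
        forall i u, U u -> cexp (L i u) = pevalC (f i) u,
        forall j u, U u -> pevalC (h j) u != 0
      & forall u, U u ->
          H u = \prod_(i < p) cexp (lam i * L i u) *
                \prod_(j < q) cexp (mu j * (pevalC (g j) u / pevalC (h j) u))].

(* U need not be connected, so "H takes two values on U" would be satisfied by
   locally constant branches such as (x^2)^(1/2) x^(-1), a first integral of
   every system; non-constancy is required on every nonempty open part. *)
Definition nonconstant_on U H : Prop :=
  forall V : set (R * R)%type, open V -> V !=set0 -> V `<=` U ->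
    exists u v, [/\ V u, V v & H u <> H v].

(* The derivative of H along the vector field (P, Q). *)
Definition vf P Q H (u : (R * R)%type) : R[i] :=
  (peval P u)%:C * partialC e_x H u + (peval Q u)%:C * partialC e_y H u.

Definition divergence P Q (u : (R * R)%type) : R :=
  'D_e_x (peval P) u + 'D_e_y (peval Q) u.

Definition first_integral P Q U H : Prop :=
  [/\ C1_onC U H, nonconstant_on U H & forall u, U u -> vf P Q H u = 0].

Definition integrating_factor P Q U H : Prop :=
  [/\ differentiable_onC U H, nonconstant_on U H
    & forall u, U u -> vf P Q H u = - (H u * (divergence P Q u)%:C)].

Definition liouvillian_integrable P Q : Prop :=
  exists U H, [/\ open U, dense U, darboux_on U H
    & first_integral P Q U H \/ integrating_factor P Q U H].

End PlanarSystems.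

(* Main.v *)
Require Import Defs.
From mathcomp Require Import all_boot all_order all_algebra.
From mathcomp Require Import all_classical all_reals all_analysis.
From mathcomp Require Import complex polyXY ring.

(**
  Along each of the four systems x is governed by dx/dt = p(x) and y by a
  Riccati equation.  With z = y + l(x), where l = beta x + gamma, and a suitable
  polynomial s in x, the four second components are all of the form
      z^2 + s z + p (k - s' - l'),
  and the Riccati equation is the one attached to
      p f'' + (p' + s) f' + k f = 0,
  the hypergeometric, Jacobi, Laguerre or Hermite equation, in the sense that
  z = - s - p f'/f solves the former whenever f solves the latter:
      (i)    p = x (1 - x), s = c - 1 - (a + b - 1) x,  k = - a b,
      (ii)   p = 1 - x^2,   s = A - B - (A + B) x,      k = n (n + A + B + 1),
      (iii)  p = x,         s = A - x,                  k = n,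
      (iv)   p = 1,         s = - 2 x,                  k = 2 n.

  Hence a nonzero polynomial solution f gives the invariant algebraic curve
  C = 0, where C = f (y + l + s) + p f'; its cofactor is y + l.
  The weight w of the differential equation, the solution of p w' = s w, is a
  Darboux function of x alone, since p splits into linear factors:
      x^(c-1) (1-x)^(a+b-c),  (1-x)^B (1+x)^A,  x^A e^(-x),  e^(-x^2).
  Comparing logarithmic derivatives along the field, 1 / (p w C^2) is an
  integrating factor ([riccati_integrable]).

  The passage from cofactors to an integrating factor is Darboux's theorem
  ([darboux_integrable]): if the F_i have cofactors K_i, the logarithm of
  prod (F_i^2)^lam_i e^G has derivative sum 2 lam_i K_i + X G along the field X,
  and the product is an integrating factor when this equals - div X.  Squares
  are used because a real F_i changes sign: F_i^2 is positive off the curve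
  F_i = 0, so the ordinary real logarithm is a global continuous branch and the
  product is real valued.  It lives on the complement of the curves F_i = 0,
  which is open, and dense because a nonzero polynomial vanishes on no open
  set.  It is not constant on any nonempty open set V: its derivative along X
  would vanish on V, hence so would div X, a nonzero polynomial.

  The polynomial f is given in (ii) and (iii).  For (i) it is the truncated
  hypergeometric series, and for (iv) the Hermite polynomial produced by the
  raising operator f |-> 2 x f - f'.
*)

Set Implicit Arguments.
Unset Strict Implicit.
Unset Printing Implicit Defensive.
Import Order.TTheory GRing.Theory Num.Theory.
Import numFieldNormedType.Exports.
Local Open Scope ring_scope.

(** * Derivatives of bivariate polynomials *)

Section Darboux.
Local Open Scope classical_set_scope.
Local Open Scope complex_scope.
Variable R : realType.
Implicit Types (F G P Q : {poly {poly R}}) (p : {poly R}).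

(** Transporting the derivative in the outer variable by the ring involution
    [swapXY] gives the Leibniz rule without computing on coefficients. *)
Definition derivY F := swapXY (swapXY F)^`().

Lemma derivYD F G : derivY (F + G) = derivY F + derivY G.
Proof. by rewrite /derivY rmorphD derivD rmorphD. Qed.

Lemma derivYM F G : derivY (F * G) = derivY F * G + F * derivY G.
Proof. by rewrite /derivY rmorphM derivM rmorphD !rmorphM /= !swapXYK. Qed.

Lemma derivY_map_polyC p : derivY p^:P = 0.
Proof. by rewrite /derivY swapXY_map_polyC derivC rmorph0. Qed.

Lemma derivY_polyC p : derivY p%:P = p^`()%:P.
Proof. by rewrite /derivY swapXY_polyC deriv_map swapXY_map_polyC. Qed.

Definition poly_vf P Q F := P * F^`() + Q * derivY F.

Lemma pevalD F G u : peval (F + G) u = peval F u + peval G u.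
Proof. by rewrite /peval !hornerD. Qed.

Lemma pevalM F G u : peval (F * G) u = peval F u * peval G u.
Proof. by rewrite /peval !hornerM. Qed.

Lemma peval_map_polyC p u : peval p^:P u = p.[u.1].
Proof. by rewrite /peval horner_map hornerC. Qed.

Lemma peval_polyC p u : peval p%:P u = p.[u.2].
Proof. by rewrite /peval hornerC. Qed.

Lemma differentiable_fstR (u : R * R) : differentiable (fst : R * R -> R) u.
Proof. by apply: linear_differentiable => w; exact: cvg_fst. Qed.

Lemma differentiable_sndR (u : R * R) : differentiable (snd : R * R -> R) u.
Proof. by apply: linear_differentiable => w; exact: cvg_snd. Qed.

Lemma derive_fst (u v : R * R) : 'D_v fst u = v.1.
Proof.
rewrite deriveE; last exact: differentiable_fstR.
by rewrite diff_lin // => w; exact: cvg_fst.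
Qed.

Lemma derive_snd (u v : R * R) : 'D_v snd u = v.2.
Proof.
rewrite deriveE; last exact: differentiable_sndR.
by rewrite diff_lin // => w; exact: cvg_snd.
Qed.

Lemma differentiable_derive_comp (V : normedModType R) (f : V -> R)
    (g : R -> R) (u : V) dg :
  differentiable f u -> is_derive (f u) (1 : R) g dg ->
  differentiable (g \o f) u /\ forall v, 'D_v (g \o f) u = 'D_v f u * dg.
Proof.
move=> df hg; have dg1 : differentiable g (f u).
  by apply/derivable1_diffP; exact: ex_derive.
have dgf : differentiable (g \o f) u by exact: differentiable_comp.
split=> // v; rewrite !deriveE // diff_comp //= diff1E //=.
by rewrite derive1E derive_val.
Qed.

(** The bridge between the formal and the analytic derivatives. *)
Lemma peval_differentiable F u : differentiable (peval F) u /\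
  forall v, 'D_v (peval F) u = v.1 * peval F^`() u + v.2 * peval (derivY F) u.
Proof.
elim/poly_ind: F => [|F p [IH1 IH2]].
  have -> : peval (0 : {poly {poly R}}) = cst 0.
    by apply/funext => w; rewrite /peval !horner0.
  split=> [|v]; first exact: differentiable_cst.
  rewrite derive_cst /derivY !(rmorph0, deriv0) /peval /= !horner0; ring.
have dX := @differentiable_fstR u.
have [dp Dp] := @differentiable_derive_comp _ snd (horner p) u _
  (differentiable_sndR u) (is_derive_poly p u.2).
have E : peval (F * 'X + p%:P) = peval F * fst + (horner p \o snd).
  by apply/funext => w; rewrite /peval !(hornerM, hornerD, hornerX, hornerC).
have dFX : differentiable (peval F * fst) u by exact: differentiableM.
split=> [|v]; rewrite E; first exact: differentiableD.
rewrite deriveD ?deriveM; try exact: diff_derivable.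
rewrite Dp derive_snd derive_fst IH2 derivD derivM derivX derivC.
rewrite derivYD derivYM derivY_polyC -(map_polyX polyC).
rewrite derivY_map_polyC /= map_polyX.
rewrite !(pevalD, pevalM) !peval_polyC -(map_polyX polyC) !peval_map_polyC.
rewrite /GRing.scale /= !hornerE; ring.
Qed.

(** * Zero sets of bivariate polynomials *)

(** A nonzero polynomial has finitely many roots, so it cannot vanish on the
    infinitely many points x + e / (k + 2) of the ball.  The embedding [iota]
    serves twice below: real numbers are evaluation points both for the outer
    polynomial, as constants of R[y], and for its coefficients. *)
Lemma nonroot_near (A : idomainType) (iota : R -> A) (p : {poly A}) (x e : R) :
  injective iota -> p != 0 -> 0 < e ->
  exists2 x', ball x e x' & p.[iota x'] != 0.
Proof.
move=> iota_inj p0 e0; apply: contrapT => noroot.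
pose z (k : nat) : R := x + e / k.+2%:R.
have zB k : ball x e (z k).
  rewrite -ball_normE /ball_ /= /z opprD addNKr normrN.
  rewrite gtr0_norm ?divr_gt0 // ltr_pdivrMr // ltr_pMr // ltr1n //.
have zI : injective z.
  move=> k l /addrI /(mulfI (lt0r_neq0 e0)) /invr_inj /eqP.
  by rewrite eqr_nat => /eqP [].
pose rs := [seq iota (z k) | k <- index_iota 0 (size p)].
have rsP : all (root p) rs.
  apply/allP => _ /mapP [k _ ->]; apply: contrapT => /negP nr.
  by apply: noroot; exists (z k).
have urs : uniq rs by rewrite map_inj_uniq ?iota_uniq // => k l /iota_inj /zI.
by have := max_poly_roots p0 rsP urs; rewrite size_map size_iota subn0 ltnn.
Qed.

Lemma dense_nonzero F : F != 0 -> dense [set u | peval F u != 0].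
Proof.
move=> F0 O [u Ou] Oopen.
have /nbhs_ballP [e /= e0 eO] : nbhs u O by exact: open_nbhs_nbhs.
have [x xe Fx] := nonroot_near u.1 (@polyC_inj R) F0 e0.
have [y ye Fxy] := @nonroot_near _ idfun _ u.2 e (@inj_id _) Fx e0.
by exists (x, y); split => //; apply: eO.
Qed.

Lemma open_nonzero F : open [set u | peval F u != 0].
Proof.
have cF : continuous (peval F).
  move=> u; apply: differentiable_continuous.
  exact: (peval_differentiable F u).1.
exact: (open_comp (D := [set x | x != 0]) (fun u _ => cF u) (@open_neq _ 0)).
Qed.

(** * Darboux's theorem *)

Lemma is_derive_ln_sqr (x : R) : x != 0 ->
  is_derive x (1 : R) (fun t => ln (t ^+ 2)) (2 / x).
Proof.
move=> x0; have x2 : 0 < x ^+ 2 by rewrite exprn_even_gt0.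
have ? := is_derive1_ln x2.
have ? : is_derive x (1 : R) (fun t : R => t ^+ 2) (2 * x).
  have := is_derive_poly ('X^2 : {poly R}) x.
  rewrite derivXn !hornerE mulr_natl (_ : horner 'X^2 = fun t => t ^+ 2) //.
  by apply/funext => t; rewrite !hornerE.
rewrite (_ : 2 / x = (x ^+ 2)^-1 * (2 * x)); last by field.
exact: is_derive1_comp.
Qed.

Lemma differentiable_derive_ln_sqr F u : peval F u != 0 ->
  let f := (fun t => ln (t ^+ 2)) \o peval F in
  differentiable f u /\
  forall v, 'D_v f u = 'D_v (peval F) u * (2 / peval F u).
Proof.
move=> Fu; apply: differentiable_derive_comp (is_derive_ln_sqr Fu).
exact: (peval_differentiable F u).1.
Qed.

Section DarbouxFactor.
Variables (n : nat) (F : 'I_n -> {poly {poly R}}) (lam : 'I_n -> R).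
Variable (G : {poly {poly R}}).

Let U := [set u : R * R | forall i, peval (F i) u != 0].

Definition potential (u : R * R) : R :=
  \sum_i lam i * ln (peval (F i) u ^+ 2) + peval G u.

Lemma potential_differentiable u : U u -> differentiable potential u /\
  forall v, 'D_v potential u =
    \sum_i lam i * ('D_v (peval (F i)) u * (2 / peval (F i) u)) +
    'D_v (peval G) u.
Proof.
move=> Uu; have dln i := differentiable_derive_ln_sqr (Uu i).
have [dG _] := peval_differentiable G u.
pose T i := lam i *: ((fun t => ln (t ^+ 2)) \o peval (F i)).
have -> : potential = \sum_i T i + peval G.
  by apply/funext => w; rewrite /potential fctE fct_sumE.
have dT i : differentiable (T i) u by apply: differentiableZ; exact: (dln i).1.
have dS : differentiable (\sum_i T i) u by exact: differentiable_sum.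
split=> [|v]; first exact: differentiableD.
rewrite deriveD; try exact: diff_derivable.
rewrite derive_sum; last by move=> i; exact: diff_derivable.
congr (_ + _); apply: eq_bigr => i _; rewrite deriveZ.
  by rewrite (dln i).2.
exact: diff_derivable (dln i).1.
Qed.

Lemma factor_differentiable u : U u ->
  differentiable (expR \o potential) u /\
  forall v, 'D_v (expR \o potential) u = 'D_v potential u * expR (potential u).
Proof.
move=> Uu; apply: differentiable_derive_comp (is_derive_expR (potential u)).
exact: (potential_differentiable Uu).1.
Qed.

Definition darboux_factor (u : R * R) : R[i] := (expR (potential u))%:C.

Lemma cexp_real (x : R) : cexp x%:C = (expR x)%:C.
Proof. by rewrite /cexp /= cos0 sin0 mulr1 mulr0. Qed.

Definition toC : {poly {poly R}} -> {poly {poly R[i]}} :=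
  map_poly (map_poly (real_complex R)).

Lemma pevalC_toC H u : pevalC (toC H) u = (peval H u)%:C.
Proof.
by rewrite /pevalC /toC /peval -!(map_polyC (real_complex R)) !horner_map.
Qed.

Lemma continuous_onC_real (f : R * R -> R) (V : set (R * R)) :
  (forall u, V u -> differentiable f u) -> continuous_onC V (fun u => (f u)%:C).
Proof.
move=> df u Vu; split; last exact: cst_continuous.
exact: differentiable_continuous (df u Vu).
Qed.

(** The Darboux data are the F_i^2, not the F_i: their real logarithms are
    branches on the whole of [U]. *)
Lemma darboux_on_factor : darboux_on U darboux_factor.
Proof.
exists n, 1%N, (fun i => toC (F i ^+ 2)), (fun i => (lam i)%:C),
  (fun i u => (ln (peval (F i) u ^+ 2))%:C),
  (fun=> toC G), (fun=> 1), (fun=> 1).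
split=> [i|i u Uu|j u _|u Uu].
- apply: continuous_onC_real => u Uu.
  exact: (differentiable_derive_ln_sqr (Uu i)).1.
- rewrite cexp_real lnK ?posrE ?exprn_even_gt0 //; last exact: Uu.
  by rewrite pevalC_toC /peval !hornerE.
- by rewrite /pevalC !hornerC oner_eq0.
rewrite /darboux_factor /potential expRD expR_sum rmorphM rmorph_prod /=.
congr (_ * _); first by apply: eq_bigr => i _; rewrite -rmorphM cexp_real.
by rewrite big_ord1 mul1r {2}/pevalC !hornerC divr1 pevalC_toC cexp_real.
Qed.

Lemma partialC_factor u v : U u ->
  partialC v darboux_factor u = ('D_v potential u * expR (potential u))%:C.
Proof.
move=> Uu; rewrite /partialC.
have -> : ReF darboux_factor = expR \o potential by [].
have -> : ImF darboux_factor = cst 0 by [].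
by rewrite (factor_differentiable Uu).2 derive_cst.
Qed.

(** Darboux's theorem.  The last hypothesis makes every integrating factor
    nonconstant: where one is locally constant, the divergence vanishes. *)
Lemma darboux_integrable (P Q : {poly {poly R}})
    (K : 'I_n -> {poly {poly R}}) :
  (forall i, F i != 0) -> (forall i, poly_vf P Q (F i) = K i * F i) ->
  \sum_i (2 * lam i)%:P%:P * K i + poly_vf P Q G = - (P^`() + derivY Q) ->
  P^`() + derivY Q != 0 ->
  liouvillian_integrable P Q.
Proof.
move=> F0 FK divE div0.
have divergenceE u : divergence P Q u = peval (P^`() + derivY Q) u.
  rewrite /divergence !(peval_differentiable _ u).2 /e_x /e_y /= pevalD; ring.
have vfE H u : peval P u * 'D_(e_x R) (peval H) u +
    peval Q u * 'D_(e_y R) (peval H) u = peval (poly_vf P Q H) u.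
  rewrite !(peval_differentiable _ u).2 /e_x /e_y /= /poly_vf pevalD !pevalM.
  ring.
have key u : U u -> vf P Q darboux_factor u =
    - (darboux_factor u * (divergence P Q u)%:C).
  move=> Uu; rewrite /vf !partialC_factor // /darboux_factor.
  rewrite -!(rmorphM (real_complex R)) -(rmorphD (real_complex R)).
  rewrite -(rmorphN (real_complex R)).
  congr (_ %:C); rewrite divergenceE.
  rewrite !(potential_differentiable Uu).2 !mulrA -mulrDl mulrC -mulrN.
  congr (_ * _).
  have /(congr1 (fun H => peval H u)) := divE.
  have -> : peval (- (P^`() + derivY Q)) u = - peval (P^`() + derivY Q) u.
    by rewrite /peval !hornerN.
  move=> <-; rewrite !mulrDr addrACA vfE [RHS]pevalD; congr (_ + _).
  rewrite !mulr_sumr -big_split /= [RHS]/peval !horner_sum.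
  apply: eq_bigr => i _.
  rewrite -/(peval _ u) pevalM peval_polyC hornerC.
  have /(congr1 (fun H => peval H u)) := FK i.
  rewrite -vfE pevalM; have := Uu i; set f := peval (F i) u => f0 fE.
  apply: (mulIf f0); rewrite -[RHS]mulrA -fE; field.
  exact: f0.
have Uopen : open U /\ dense U.
  pose F' := \prod_i F i.
  have -> : U = [set u | peval F' u != 0].
    apply/funext => u; rewrite /= /peval /F' !horner_prod; apply/propext.
    split=> [Uu|/prodf_neq0 Uu i]; last exact: Uu.
    by apply/prodf_neq0 => i _; exact: Uu.
  split; first exact: open_nonzero.
  by apply: dense_nonzero; apply/prodf_neq0 => i _; exact: F0.
exists U, darboux_factor; split.
- exact: Uopen.1.
- exact: Uopen.2.
- exact: darboux_on_factor.
right; split=> // [u Uu|V Vopen V0 VU].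
  split; last exact: differentiable_cst.
  exact: (factor_differentiable Uu).1.
apply: contrapT => cstH.
(* a point of V where the divergence does not vanish *)
have [u [Vu /= du]] := dense_nonzero div0 V0 Vopen.
have hcst w : V w -> expR (potential w) = expR (potential u).
  move=> Vw; apply: contrapT => ne; apply: cstH; exists w, u; split=> // -[].
  exact: ne.
have D0 v : partialC v darboux_factor u = 0.
  rewrite /partialC.
  have -> : ImF darboux_factor = cst 0 by [].
  rewrite derive_cst (_ : 'D_v _ u = 'D_v (cst (expR (potential u))) u).
    by rewrite derive_cst.
  apply: near_eq_derive.
  by apply: filterS (open_nbhs_nbhs (conj Vopen Vu)) => w /hcst.
have := key u (VU u Vu); rewrite /vf !D0 !mulr0 addr0 => /esym/eqP.
rewrite oppr_eq0 mulf_eq0 divergenceE /darboux_factor.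
rewrite !(eq_complex, eqxx, andbT) /=.
by rewrite (negPf du) orbF gt_eqF // expR_gt0.
Qed.
End DarbouxFactor.
End Darboux.

(** * Riccati systems with a polynomial solution of the linear equation *)

Section Riccati.
Variable R : realType.
Implicit Types (p q f g l s : {poly R}).

(** The second component of the system whose Riccati equation, in the unknown
    y + l, is the one attached to p f'' + (p' + s) f' + k f = 0. *)
Definition riccati p s l (k : R) : {poly {poly R}} :=
  ('Y + l^:P) ^+ 2 + s^:P * ('Y + l^:P) + (p * (k%:P - s^`() - l^`()))^:P.

(** The hypothesis on [s] says that w = p1^al p2^de e^g satisfies p w' = s w.
    Since p = p1 p2, the integrating factor is
    1 / (p w C^2) = p1^(-1-al) p2^(-1-de) e^(-g) C^(-2). *)
Lemma riccati_integrable p1 p2 s l f g (al de k : R) :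
  let p := p1 * p2 in
  p1 != 0 -> p2 != 0 -> f != 0 ->
  p * f^`(2) + (p^`() + s) * f^`() + k%:P * f = 0 ->
  s = al%:P * p1^`() * p2 + de%:P * p1 * p2^`() + p * g^`() ->
  liouvillian_integrable p^:P (riccati p s l k).
Proof.
move=> p p10 p20 f0 ode weight.
pose C := f^:P * ('Y + l^:P + s^:P) + (p * f^`())^:P.
have map0 q : q != 0 -> q^:P != 0.
  by move=> q0; rewrite map_poly_eq0_id0 // polyC_eq0 lead_coef_eq0.
have dYY : derivY ('Y : {poly {poly R}}) = 1 by rewrite derivY_polyC derivX.
have dYQ : derivY (riccati p s l k) = 2 * ('Y + l^:P) + s^:P.
  rewrite /riccati expr2 !(derivYD, derivYM, dYY) !derivY_map_polyC; ring.
have dYC : derivY C = f^:P.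
  rewrite /C !(derivYD, derivYM, dYY) !derivY_map_polyC; ring.
(* the exponents are halved because they apply to squares *)
apply: (@darboux_integrable R 3 (nth 0 [:: C; p1^:P; p2^:P])
   (nth 0 [:: -1; - (1 + al) / 2; - (1 + de) / 2]) (- g^:P)
   _ _ (nth 0 [:: 'Y + l^:P; (p1^`() * p2)^:P; (p1 * p2^`())^:P])).
- move=> [[|[|[|//]]] lti] /=; [|exact: map0|exact: map0].
  apply: contra_neq (map0 _ f0) => C0; rewrite -dYC C0 /derivY.
  by rewrite !(rmorph0, deriv0).
- move=> [[|[|[|//]]] lti] /=; rewrite /poly_vf ?dYC ?derivY_map_polyC.
  + have := congr1 (map_poly polyC) ode.
    rewrite /p derivM.
    rewrite /C /riccati !(derivD, derivM, deriv_map, derivC, derivX).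
    rewrite add0r !(rmorphD, rmorphM, rmorphN, rmorph0, rmorphB) /= -/f^`(2).
    set u := (f^`(2))^:P; set u1 := f^`()^:P; set u0 := f^:P.
    (* the two sides differ by p times the differential equation *)
    move=> ode'; apply/eqP; rewrite -subr_eq0; apply/eqP.
    rewrite -[RHS](mulr0 (p1 * p2)^:P) -ode' !rmorphM /=.
    ring.
  + rewrite deriv_map !rmorphM /=; ring.
  + rewrite deriv_map !rmorphM /=; ring.
- rewrite !big_ord_recl big_ord0 /= dYQ /poly_vf weight /p.
  rewrite -!rmorphN /= derivY_map_polyC !deriv_map derivM derivN /=.
  rewrite !(rmorphD, rmorphM, rmorphN, rmorph0, rmorphB) /= !map_polyC /=.
  have half (x : {poly {poly R}}) : (1 + 1) * (- x * (2^-1 : R)%:P%:P) = - x.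
    have -> : (1 + 1 : {poly {poly R}}) = (2 : R)%:P%:P by rewrite !polyC_natr.
    by rewrite mulrCA -!polyCM divff ?pnatr_eq0 // mulr1.
  by rewrite !polyC1 !half; ring.
(* the divergence is affine in y with leading coefficient 2 *)
apply/eqP => div0; have : derivY (p^:P^`() + derivY (riccati p s l k)) = 0.
  by rewrite div0 /derivY !(rmorph0, deriv0).
rewrite dYQ deriv_map mulr_natl mulr2n !derivYD !derivY_map_polyC.
rewrite dYY !addr0 add0r.
by move/eqP; rewrite -mulr2n -!polyC_natr !polyC_eq0 pnatr_eq0.
Qed.
End Riccati.

(** * Polynomial solutions of the Hermite and hypergeometric equations *)

Section PolynomialSolutions.
Variable R : realType.

(** With L = d^2 - 2 x d one has
    L (2 x f - f') = (2 x - d) (L f) - 2 (2 x f - f'), so f |-> 2 x f - f' lowers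
    the eigenvalue of L by 2; it raises the degree by one, hence preserves
    nonzero polynomials. *)
Lemma hermite_polynomial n : exists f : {poly R}, f != 0 /\
  f^`(2) + (- 2%:P * 'X) * f^`() + (2 * n%:R)%:P * f = 0.
Proof.
elim: n => [|n [f [f0 fE]]].
  exists 1; split; first exact: oner_neq0.
  by rewrite /= -polyC1 !derivC; ring.
exists (2%:P * 'X * f - f^`()); split.
  have sz : (size f^`() < size (2%:P * 'X * f)%R)%N.
    rewrite -mulrA mul_polyC size_scale ?pnatr_eq0 // mulrC size_mulX //.
    by rewrite ltnS ltnW // lt_size_deriv.
  rewrite -size_poly_eq0 size_polyDl ?size_polyN // -lt0n.
  exact: leq_ltn_trans sz.
have dE : f^`()^`()^`() =
    - (- 2%:P * f^`() - 2%:P * 'X * f^`()^`() + (2 * n%:R)%:P * f^`()).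
  apply/eqP; rewrite -addr_eq0; apply/eqP; have := congr1 deriv fE.
  by rewrite !(derivD, derivM, derivN, derivC, derivX) => <-; rewrite /=; ring.
have eE : f^`()^`() = - (- 2%:P * 'X * f^`() + (2 * n%:R)%:P * f).
  by apply/eqP; rewrite -addr_eq0 addrA fE.
rewrite /= !(derivD, derivM, derivN, derivC, derivX) dE eE.
rewrite (_ : n.+1%:R = n%:R + 1) -?natr1 // !polyCM !polyCD !polyC1; ring.
Qed.

(** The differential equation is the recurrence
    (k + 1) (k + c) w_(k+1) = (k + a) (k + b) w_k on coefficients; the factor
    k + a vanishes at k = m and stops the series. *)
Lemma hypergeometric_polynomial (a b c : R) (m : nat) :
  a = - m%:R -> (forall k : nat, c <> - k%:R) ->
  exists f : {poly R}, f != 0 /\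
  'X * (1 - 'X) * f^`(2) + (c%:P - (a + b + 1)%:P * 'X) * f^`()
   - (a * b)%:P * f = 0.
Proof.
move=> am hc.
have kc (k : nat) : k%:R + c != 0.
  by rewrite addrC addr_eq0; apply/eqP/hc.
pose ratio (k : nat) : R :=
  (k%:R + a) * (k%:R + b) / ((k%:R + 1) * (k%:R + c)).
pose w (k : nat) : R := \prod_(j < k) ratio j.
have wS k : (k%:R + 1) * (k%:R + c) * w k.+1 = (k%:R + a) * (k%:R + b) * w k.
  have k1 : k%:R + 1 != 0 :> R by rewrite natr1 pnatr_eq0.
  by rewrite /w big_ord_recr /= /ratio; field; rewrite k1 kc.
have w0 k : (m < k)%N -> w k = 0.
  move=> mk; apply/eqP/prodf_eq0; exists (Ordinal mk) => //=.
  by rewrite /ratio am subrr !mul0r.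
have [f fE] : exists f : {poly R}, forall k, f`_k = w k.
  exists (\poly_(k < m.+1) w k) => k.
  by rewrite coef_poly ltnS; case: leqP => // /w0.
exists f; split.
  apply/eqP => /(congr1 (fun q : {poly R} => q`_0)).
  by rewrite fE coef0 => /eqP; rewrite /w big_ord0 oner_eq0.
apply/polyP => k; rewrite coef0.
have -> : 'X * (1 - 'X) * f^`(2) + (c%:P - (a + b + 1)%:P * 'X) * f^`()
   - (a * b)%:P * f = f^`(2) * 'X - f^`(2) * 'X * 'X + c%:P * f^`()
   - (a + b + 1)%:P * (f^`() * 'X) - (a * b)%:P * f by ring.
rewrite !(coefB, coefD, coefCM, coefMX) !coef_deriv !fE.
have /eqP := wS k; rewrite -subr_eq0 => /eqP wSk; apply: etrans wSk.
by case: k => [|[|k]] /=; ring.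
Qed.
End PolynomialSolutions.

(** * The four families *)

Theorem theorem9 (R : realType) (beta gamma a b c A B : R) (n : nat)
    (hab : (exists m : nat, a = - m%:R) \/ (exists m : nat, b = - m%:R)) :
  [/\ (* (i) *)
      (forall m : nat, c <> - m%:R) ->
      liouvillian_integrable
        ('X * (1 - 'X))
        ('Y ^+ 2 + (2 * beta - a - b + 1)%:K2 * 'X * 'Y
         + (c - 1 + 2 * gamma)%:K2 * 'Y
         + (gamma * (gamma + c - 1))%:K2
         + (beta ^+ 2 + (2 - a - b) * beta + (a - 1) * (b - 1))%:K2 * 'X ^+ 2
         + (c * beta - a * b
            + (1 - gamma) * (- 2 * beta - 1 + a + b))%:K2 * 'X),
      (* (ii) *)
      (exists f : {poly R}, size f = n.+1 /\
         (1 - 'X ^+ 2) * f^`(2) + ((A - B)%:P - (A + B + 2)%:P * 'X) * f^`()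
         + (n%:R * (n%:R + A + B + 1))%:P * f = 0) ->
      liouvillian_integrable
        (1 - 'X ^+ 2)
        ('Y ^+ 2 + (2 * beta - A - B)%:K2 * 'X * 'Y
         + (2 * gamma + A - B)%:K2 * 'Y
         + (beta ^+ 2 + beta - n%:R * (n%:R + 1)
            - (1 + n%:R + beta) * (A + B))%:K2 * 'X ^+ 2
         + ((beta - gamma) * A - (gamma + beta) * B
            + 2 * gamma * beta)%:K2 * 'X
         + ((n%:R + 1 - gamma) * B + (n%:R + 1 + gamma) * A
            + n%:R * (n%:R + 1) + gamma ^+ 2 - beta)%:K2),
      (* (iii) *)
      (exists f : {poly R}, size f = n.+1 /\
         'X * f^`(2) + ((A + 1)%:P - 'X) * f^`() + (n%:R)%:P * f = 0) ->
      liouvillian_integrable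
        'X
        ('Y ^+ 2 + (2 * beta - 1)%:K2 * 'X * 'Y
         + (2 * gamma + A)%:K2 * 'Y
         + ((beta - 1) * beta)%:K2 * 'X ^+ 2
         + (beta * (A + 2 * gamma - 1) + n%:R + 1 - gamma)%:K2 * 'X
         + (A * gamma + gamma ^+ 2)%:K2)
    & (* (iv): the image of y' = y^2 - 2 x y + 2 (n + 1) under
         y |-> y + beta x + gamma, whence the coefficient 2 beta - 2 of x y *)
      liouvillian_integrable
        1
        ('Y ^+ 2 + (2 * beta - 2)%:K2 * 'X * 'Y
         + (2 * gamma)%:K2 * 'Y
         + (beta ^+ 2 - 2 * beta)%:K2 * 'X ^+ 2
         + (2 * gamma * (beta - 1))%:K2 * 'X
         + (gamma ^+ 2 - beta + 2 * (n%:R + 1))%:K2)].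
Proof.
have mapX : ('X : {poly R})^:P = 'X by exact: map_polyX.
have mapC (x : R) : x%:P^:P = x%:P%:P by exact: map_polyC.
(* pushes [map_poly polyC] and the derivative down to the variables and the
   constants, after which [ring] compares the two sides *)
have expand := (rmorphD, rmorphM, rmorphN, rmorphB, rmorph0, rmorph1, rmorphXn,
  mapC, mapX, derivD, derivN, derivM, derivC, derivX, polyC1).
have reduce (P Q : {poly {poly R}}) p s l k : P = p^:P -> Q = riccati p s l k ->
    liouvillian_integrable p^:P (riccati p s l k) -> liouvillian_integrable P Q.
  by move=> -> ->.
pose l : {poly R} := beta%:P * 'X + gamma%:P.
have nz (p : {poly R}) k : p`_k != 0 -> p != 0.
  by apply: contra_neq => ->; rewrite coef0.
split.
- move=> hc.
  have [f [f0 fE]] : exists f : {poly R}, f != 0 /\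
      'X * (1 - 'X) * f^`(2) + (c%:P - (a + b + 1)%:P * 'X) * f^`()
      - (a * b)%:P * f = 0.
    case: hab => -[m /hypergeometric_polynomial]; first exact.
    by move=> /(_ a c hc); rewrite (addrC b) (mulrC b).
  apply: (reduce _ _ ('X * (1 - 'X)) ((c - 1)%:P - (a + b - 1)%:P * 'X) l
    (- (a * b))).
  + by rewrite !expand /= ?expand.
  + rewrite /riccati /l !expand /= ?expand; ring.
  apply: (@riccati_integrable R 'X (1 - 'X) _ _ f 0 (c - 1) (a + b - c)) => //.
  + by rewrite polyX_eq0.
  + apply: (nz _ 0%N); rewrite coefB coef1 coefX subr0; exact: oner_neq0.
  + rewrite -[RHS]fE !expand; ring.
  + rewrite !expand; ring.
- move=> [f [sf fE]].
  have f0 : f != 0 by rewrite -size_poly_eq0 sf.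
  apply: (reduce _ _ (1 - 'X ^+ 2) ((A - B)%:P - (A + B)%:P * 'X) l
    (n%:R * (n%:R + A + B + 1))).
  + by rewrite !expr2 !expand /= ?expand.
  + rewrite /riccati /l expr2 !expand /= ?expand; ring.
  rewrite (_ : 1 - 'X ^+ 2 = (1 - 'X) * (1 + 'X)); last by ring.
  apply: (@riccati_integrable R (1 - 'X) (1 + 'X) _ _ f 0 B A) => //.
  + apply: (nz _ 0%N); rewrite coefB coef1 coefX subr0; exact: oner_neq0.
  + apply: (nz _ 0%N); rewrite coefD coef1 coefX addr0; exact: oner_neq0.
  + rewrite -[RHS]fE !expand; ring.
  + rewrite !expand; ring.
- move=> [f [sf fE]].
  have f0 : f != 0 by rewrite -size_poly_eq0 sf.
  apply: (reduce _ _ 'X (A%:P - 'X) l n%:R).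
  + by rewrite !expand /= ?expand.
  + rewrite /riccati /l !expand /= ?expand; ring.
  rewrite -['X]mulr1.
  apply: (@riccati_integrable R 'X 1 _ _ f (- 'X) A 0) => //.
  + by rewrite polyX_eq0.
  + exact: oner_neq0.
  + rewrite -[RHS]fE !expand; ring.
  + rewrite -polyC1 !expand; ring.
have [f [f0 fE]] := hermite_polynomial R n.
apply: (reduce _ _ 1 (- 2%:P * 'X) l (2 * n%:R)).
+ by rewrite !expand /= ?expand.
+ rewrite /riccati /l !expand /= ?expand; ring.
rewrite -[1 : {poly R}]mulr1.
apply: (@riccati_integrable R 1 1 _ _ f (- 'X ^+ 2) 0 0) => //.
+ exact: oner_neq0.
+ exact: oner_neq0.
+ rewrite -[RHS]fE -polyC1 !expand; ring.
+ rewrite -polyC1 expr2 !expand; ring.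
Qed.
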